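(* Let (P) be the two-stage linear adaptive robust optimization problem described in the context with a simplex uncertainty set, i.e., $U=\mathrm{Conv}(\bm{z}^1,\dots,\bm{z}^{L+1})$ with $\bm{z}^1,\dots,\bm{z}^{L+1}\in\mathbb{R}^L$ affinely independent. Then for each $\bm{x}$ that is adaptive robustly optimal (ARO) to (P) there exists a linear decision rule $\bm{y}(\cdot)$ such that the pair $(\bm{x},\bm{y}(\cdot))$ is ARO to (P).
   Context: Problem (P): $\min_{\bm{x},\bm{y}(\cdot)}\max_{\bm{z}\in U}\ \bm{c}(\bm{z})^{\top}\bm{x}+\bm{d}^{\top}\bm{y}(\bm{z})$ subject to $\bm{A}(\bm{z})\bm{x}+\bm{B}\bm{y}(\bm{z})\le \bm{r}(\bm{z})$ for all $\bm{z}\in U$. Here $U\subseteq\mathbb{R}^L$ is compact and convex with nonempty relative interior; $\bm{x}\in\mathbb{R}^{n_x}$ (Stage-1 decision); $\bm{y}\in\mathcal{R}^{L,n_y}$ (Stage-2 decision rule), where $\mathcal{R}^{L,n_y}$ is the set of measurable functions $\mathbb{R}^L\to\mathbb{R}^{n_y}$ that are bounded on compact sets; $\bm{B}\in\mathbb{R}^{m\times n_y}$ and $\bm{d}\in\mathbb{R}^{n_y}$ are constant; $\bm{A}(\bm{z})\in\mathbb{R}^{m\times n_x}$, $\bm{r}(\bm{z})\in\mathbb{R}^m$, $\bm{c}(\bm{z})\in\mathbb{R}^{n_x}$ depend affinely on $\bm{z}$. A pair $(\bm{x},\bm{y}(\cdot))$ is adaptive robustly feasible (ARF) if it satisfies all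 constraints of (P); $\bm{x}$ is ARF if some $\bm{y}(\cdot)\in\mathcal{R}^{L,n_y}$ makes $(\bm{x},\bm{y}(\cdot))$ ARF, and $\mathcal{X}$ is the set of ARF $\bm{x}$. $\mathrm{OPT}$ is the optimal (worst-case) value of (P). Standing assumptions: $\mathcal{X}\ne\emptyset$ and $\mathrm{OPT}$ is finite. A pair is adaptive robustly optimal (ARO) if it is ARF and $\bm{c}(\bm{z})^{\top}\bm{x}+\bm{d}^{\top}\bm{y}(\bm{z})\le\mathrm{OPT}$ for all $\bm{z}\in U$; $\bm{x}$ is ARO if some $\bm{y}(\cdot)$ makes the pair ARO. A linear decision rule (LDR) is a decision rule depending affinely on $\bm{z}$: $\bm{y}(\bm{z})=\bm{u}+\bm{V}\bm{z}$ with $\bm{u}\in\mathbb{R}^{n_y}$, $\bm{V}\in\mathbb{R}^{n_y\times L}$. *)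

(* Defs.v *)
From HB Require Import structures.
From mathcomp Require Import all_boot all_order all_algebra.
From mathcomp Require Import all_classical all_reals all_analysis.

Set Implicit Arguments.
Unset Strict Implicit.
Unset Printing Implicit Defensive.

Import Order.TTheory GRing.Theory Num.Theory.
Import numFieldNormedType.Exports.

Local Open Scope classical_set_scope.
Local Open Scope ring_scope.

Definition affine_map (R : realType) (L : nat) (V : lmodType R)
    (f : 'cV[R]_L -> V) : Prop :=
  exists (v0 : V) (v : 'I_L -> V),
    forall z, f z = v0 + \sum_(l < L) z l 0 *: v l.

Definition conv_hull (R : realType) (V : lmodType R) (n : nat)
    (p : 'I_n -> V) : set V :=
  [set x | exists w : 'I_n -> R,
    [/\ forall i, 0 <= w i, \sum_(i < n) w i = 1
      & x = \sum_(i < n) w i *: p i]].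

Definition aff_hull (R : realType) (V : lmodType R) (A : set V) : set V :=
  [set x | exists (n : nat) (p : 'I_n -> V) (w : 'I_n -> R),
    [/\ forall i, A (p i), \sum_(i < n) w i = 1
      & x = \sum_(i < n) w i *: p i]].

Definition relative_interior (R : realType) (L : nat) (A : set 'cV[R]_L) :
    set 'cV[R]_L :=
  [set x | A x /\ exists2 e : R, 0 < e & ball x e `&` aff_hull A `<=` A].

Definition affinely_independent (R : realType) (L n : nat)
    (p : 'I_n.+1 -> 'cV[R]_L) : bool :=
  free [seq p (lift ord0 i) - p ord0 | i : 'I_n].

(* Measurability is with respect to the Borel sigma-algebras, those generated
   by the open sets. *)
Definition decision_rules (R : realType) (L ny : nat) :
    set ('cV[R]_L -> 'cV[R]_ny) :=
  [set y : 'cV[R]_L -> 'cV[R]_ny |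
           measurable_fun setT
             (y : g_sigma_algebraType (@open 'cV[R]_L) ->
                  g_sigma_algebraType (@open 'cV[R]_ny))
           /\ forall K : set 'cV[R]_L, compact K -> [bounded y z | z in K]].

Definition is_LDR (R : realType) (L ny : nat)
    (y : 'cV[R]_L -> 'cV[R]_ny) : Prop :=
  exists (u : 'cV[R]_ny) (V : 'M[R]_(ny, L)), forall z, y z = u + V *m z.

Record two_stage_problem (R : realType) (L nx ny m : nat) := TwoStageProblem {
  uncertainty : set 'cV[R]_L;
  Amx : 'cV[R]_L -> 'M[R]_(m, nx);
  Bmx : 'M[R]_(m, ny);
  rhs : 'cV[R]_L -> 'cV[R]_m;
  cost1 : 'cV[R]_L -> 'cV[R]_nx;
  cost2 : 'cV[R]_ny;
  uncertainty_compact : compact uncertainty;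
  uncertainty_convex : convex_set uncertainty;
  uncertainty_relint : relative_interior uncertainty !=set0;
  Amx_affine : affine_map Amx;
  rhs_affine : affine_map rhs;
  cost1_affine : affine_map cost1
}.

Definition objective (R : realType) (L nx ny m : nat)
    (P : two_stage_problem R L nx ny m)
    (x : 'cV[R]_nx) (y : 'cV[R]_L -> 'cV[R]_ny) (z : 'cV[R]_L) : R :=
  ((cost1 P z)^T *m x + (cost2 P)^T *m y z) 0 0.

(* ARF: adaptive robustly feasible; ARO: adaptive robustly optimal. *)
Definition ARF_pair (R : realType) (L nx ny m : nat)
    (P : two_stage_problem R L nx ny m)
    (x : 'cV[R]_nx) (y : 'cV[R]_L -> 'cV[R]_ny) : Prop :=
  @decision_rules R L ny y /\
  forall z, uncertainty P z ->
    forall i : 'I_m, (Amx P z *m x + Bmx P *m y z) i 0 <= rhs P z i 0.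

Definition ARF (R : realType) (L nx ny m : nat)
    (P : two_stage_problem R L nx ny m) : set 'cV[R]_nx :=
  [set x | exists y, ARF_pair P x y].

Definition worst_case (R : realType) (L nx ny m : nat)
    (P : two_stage_problem R L nx ny m)
    (x : 'cV[R]_nx) (y : 'cV[R]_L -> 'cV[R]_ny) : \bar R :=
  ereal_sup [set (objective P x y z)%:E | z in uncertainty P].

(* The optimal value is an infimum of suprema: decision rules need not be
   continuous and attainment is not presupposed. *)
Definition OPT (R : realType) (L nx ny m : nat)
    (P : two_stage_problem R L nx ny m) : \bar R :=
  ereal_inf [set worst_case P xy.1 xy.2 | xy in
    [set xy : 'cV[R]_nx * ('cV[R]_L -> 'cV[R]_ny) | ARF_pair P xy.1 xy.2]].

Definition ARO_pair (R : realType) (L nx ny m : nat)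
    (P : two_stage_problem R L nx ny m)
    (x : 'cV[R]_nx) (y : 'cV[R]_L -> 'cV[R]_ny) : Prop :=
  ARF_pair P x y /\
  forall z, uncertainty P z -> ((objective P x y z)%:E <= OPT P)%E.

Definition ARO (R : realType) (L nx ny m : nat)
    (P : two_stage_problem R L nx ny m) : set 'cV[R]_nx :=
  [set x | exists y, ARO_pair P x y].

(* Main.v *)
(* Let the linear decision rule interpolate an optimal decision rule at the
   L + 1 vertices of the simplex. For a fixed x the constraints and the
   objective are affine in z along an affine rule, so they inherit from the
   vertices the bounds satisfied there by the original rule. *)
Require Import Defs.
From HB Require Import structures.
From mathcomp Require Import all_boot all_order all_algebra.
From mathcomp Require Import all_classical all_reals all_analysis.

Set Implicit Arguments.
Unset Strict Implicit.
Unset Printing Implicit Defensive.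

Import Order.TTheory GRing.Theory Num.Theory.
Import numFieldNormedType.Exports.

Local Open Scope classical_set_scope.
Local Open Scope ring_scope.

(** Since the weights sum to 1, the constant term [v0] is recovered exactly; the rest is linear in
    [z]. The signs of the weights do not matter here. *)
Lemma affine_map_sum (R : realType) (L n : nat) (V : lmodType R)
    (f : 'cV[R]_L -> V) (w : 'I_n -> R) (p : 'I_n -> 'cV[R]_L) :
  affine_map f -> \sum_i w i = 1 ->
  f (\sum_i w i *: p i) = \sum_i w i *: f (p i).
Proof.
move=> [v0 [v fE]] w1; rewrite fE.
under [RHS]eq_bigr do rewrite fE scalerDr.
rewrite big_split /= -scaler_suml w1 scale1r; congr (_ + _).
under [RHS]eq_bigr do rewrite scaler_sumr.
rewrite exchange_big; apply: eq_bigr => l _.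
rewrite summxE scaler_suml; apply: eq_bigr => i _.
by rewrite mxE scalerA.
Qed.

Lemma affine_mapD (R : realType) (L : nat) (V : lmodType R)
    (f g : 'cV[R]_L -> V) :
  affine_map f -> affine_map g -> affine_map (fun z => f z + g z).
Proof.
move=> [v0 [v fE]] [w0 [w gE]]; exists (v0 + w0), (fun l => v l + w l) => z.
under eq_bigr do rewrite scalerDr.
by rewrite big_split /= fE gE addrACA.
Qed.

Lemma linear_affine_map (R : realType) (L : nat) (V W : lmodType R)
    (g : {linear V -> W}) (f : 'cV[R]_L -> V) :
  affine_map f -> affine_map (fun z => g (f z)).
Proof.
move=> [v0 [v fE]]; exists (g v0), (fun l => g (v l)) => z.
rewrite fE linearD linear_sum; congr (_ + _).
by apply: eq_bigr => l _; rewrite linearZ.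
Qed.

Lemma LDR_affine_map (R : realType) (L ny : nat)
    (y : 'cV[R]_L -> 'cV[R]_ny) : is_LDR y -> affine_map y.
Proof.
move=> [u [V yE]]; exists u, (fun l => col l V) => z; rewrite yE.
congr (_ + _); apply/colP => i; rewrite mxE summxE.
by apply: eq_bigr => l _; rewrite !mxE mulrC.
Qed.

(** The entry at [z] is the weighted average of the entries at the points [p k], and [c] is the same
    average of copies of itself; nonnegative weights allow a termwise comparison. *)
Lemma affine_map_conv_hull_le (R : realType) (L n a b : nat)
    (f : 'cV[R]_L -> 'M[R]_(a, b)) (p : 'I_n -> 'cV[R]_L)
    (i : 'I_a) (j : 'I_b) (c : R) :
  affine_map f -> (forall k, f (p k) i j <= c) ->
  forall z, conv_hull p z -> f z i j <= c.
Proof.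
move=> faff fpc _ [w [w0 w1 ->]].
rewrite (affine_map_sum p faff w1) summxE -[c]mul1r -w1 mulr_suml.
by apply: ler_sum => k _; rewrite mxE ler_wpM2l.
Qed.

Lemma conv_hull_vertex (R : realType) (V : lmodType R) (n : nat)
    (p : 'I_n -> V) (i : 'I_n) : conv_hull p (p i).
Proof.
exists (fun k => (k == i)%:R); split => [k||].
- by rewrite ler0n.
- by rewrite (bigD1 i) //= eqxx big1 ?addr0 // => k /negbTE ->.
- rewrite (bigD1 i) //= eqxx scale1r big1 ?addr0 // => k /negbTE ->.
  by rewrite scale0r.
Qed.

Lemma affine_map_continuous (R : realType) (L : nat) (V : normedModType R)
    (f : 'cV[R]_L -> V) : affine_map f -> continuous f.
Proof.
move=> [v0 [v /funext ->]] z.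
apply: continuousD; first exact: cst_continuous.
apply: continuous_big => [ab|l _]; first exact: cvgD cvg_fst cvg_snd.
move=> t; apply: continuousZr_tmp; exact: (@coord_continuous R L 1 l 0 t).
Qed.

(** Makes affine rules admissible. Measurability need only be tested on open sets, which generate
    the Borel sets; boundedness holds because the image of a compact set is compact. *)
Lemma continuous_decision_rule (R : realType) (L ny : nat)
    (y : 'cV[R]_L -> 'cV[R]_ny) : continuous y -> decision_rules y.
Proof.
move=> ycont; split.
  apply: (@measurability _ _ (g_sigma_algebraType _) (g_sigma_algebraType _) _ _
    open) => // _ [A oA <-].
  apply: sub_sigma_algebra; rewrite setTI.
  by move/continuousP : ycont; exact.
move=> K Kco.
have /compact_bounded : compact (y @` K).
  by apply: continuous_compact => //; exact: continuous_subspaceT.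
by move=> [M [Mreal yM]]; exists M; split => // r /yM yr z Kz; apply: yr; exists z.
Qed.

(** The edge vectors leaving [p ord0] are linearly independent, so a linear map can send them to any
    prescribed vectors; a translation then fixes the value at [p ord0]. *)
Lemma LDR_interpolation (R : realType) (L ny n : nat)
    (p : 'I_n.+1 -> 'cV[R]_L) (q : 'I_n.+1 -> 'cV[R]_ny) :
  affinely_independent p ->
  exists2 y : 'cV[R]_L -> 'cV[R]_ny, is_LDR y & forall i, y (p i) = q i.
Proof.
move=> p_indep.
pose M := \matrix_(i < n) (p (lift ord0 i) - p ord0)^T.
pose Q := \matrix_(i < n) (q (lift ord0 i) - q ord0)^T.
have M_free : row_free M.
  apply: inj_row_free => v vM0; apply/rowP => i; rewrite mxE.
  (* A row [v] with [v *m M = 0] is, after transposition, a vanishing combination of the edges; the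
     tuple form lets [freeP] apply. *)
  pose X := map_tuple (fun k => p (lift ord0 k) - p ord0) (ord_tuple n).
  have /freeP X_free : free X := p_indep.
  apply: (X_free (v 0)); apply: trmx_inj; rewrite trmx0 -vM0.
  rewrite mulmx_sum_row linear_sum; apply: eq_bigr => k _.
  by rewrite -(tnth_nth 0 X k) tnth_map tnth_ord_tuple linearZ rowK.
(* [B] is a right inverse of [M], so row [i] of [M *m (B *m Q)] is row [i] of [Q]: [V] carries the
   edges of [p] to those of [q]. *)
have [B MB] := row_freeP M_free.
pose V := (B *m Q)^T.
have VE i : V *m (p (lift ord0 i) - p ord0) = q (lift ord0 i) - q ord0.
  apply: trmx_inj; rewrite trmx_mul trmxK.
  rewrite -(rowK (fun i => (p (lift ord0 i) - p ord0)^T) i) -/M -row_mul.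
  by rewrite mulmxA MB mul1mx rowK.
exists (fun z => q ord0 - V *m p ord0 + V *m z).
  by exists (q ord0 - V *m p ord0), V.
move=> i; rewrite -addrA [X in _ + X]addrC -mulmxBr.
have [j ->|->] := unliftP ord0 i.
  by rewrite VE addrC subrK.
by rewrite subrr mulmx0 addr0.
Qed.

Theorem corollary5 (R : realType) (L nx ny m : nat)
    (P : two_stage_problem R L nx ny m)
    (p : 'I_L.+1 -> 'cV[R]_L)
    (p_indep : affinely_independent p)
    (U_simplex : uncertainty P = conv_hull p)
    (ARF_nonempty : ARF P !=set0)
    (OPT_finite : OPT P \is a fin_num) :
  forall x : 'cV[R]_nx, ARO P x ->
    exists2 y : 'cV[R]_L -> 'cV[R]_ny, is_LDR y & ARO_pair P x y.
Proof.
move=> x [y0 [[_ y0_feas] y0_opt]].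
have [y y_LDR y_p] := LDR_interpolation (y0 \o p) p_indep.
have y_aff := LDR_affine_map y_LDR.
have Up i : uncertainty P (p i) by rewrite U_simplex; exact: conv_hull_vertex.
exists y => //; split; [split|].
- exact/continuous_decision_rule/affine_map_continuous.
- rewrite U_simplex => z Uz i.
  (* The right-hand side varies with [z], so it is moved to the left to obtain the constant bound
     0. *)
  pose lhs z := Amx P z *m x + Bmx P *m y z.
  have aff : affine_map (fun z => lhs z - rhs P z).
    apply: affine_mapD; last exact: (linear_affine_map -%R (rhs_affine P)).
    apply: affine_mapD; last exact: linear_affine_map.
    exact: (linear_affine_map (mulmxr x) (Amx_affine P)).
  have lhsE t : (lhs t - rhs P t) i 0 = lhs t i 0 - rhs P t i 0 by rewrite !mxE.
  rewrite -subr_le0 -lhsE.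
  apply: (affine_map_conv_hull_le aff) Uz => k.
  by rewrite lhsE subr_le0 /lhs y_p y0_feas.
(* Finiteness turns [OPT P] into a real constant that can serve as the bound at the vertices. *)
- rewrite U_simplex => z Uz; rewrite -(fineK OPT_finite) lee_fin.
  have aff : affine_map (fun z => (cost1 P z)^T *m x + (cost2 P)^T *m y z).
    apply: affine_mapD; last exact: linear_affine_map.
    apply: (linear_affine_map (mulmxr x)).
    exact: (linear_affine_map trmx (cost1_affine P)).
  apply: (affine_map_conv_hull_le aff) Uz => k.
  by rewrite y_p -lee_fin (fineK OPT_finite); exact: y0_opt.
Qed.
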